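(* Let $A, B$ be topological Abelian groups. The canonical map $$\bar{E}\colon \Sigma_{A,B}/{\sim}\;\to\; E^{ws}_{\mathbf{TA}}(A,B),\qquad [+']\mapsto [E_{+'}],$$ where $E_{+'}=\big((B,+)\xrightarrow{i_1}(B\times A,+')\xrightarrow{p_2}(A,+)\big)$, is a pointed bijection. Moreover, there is an Abelian group structure on $\Sigma_{A,B}/{\sim}$, induced by $\bar{E}$, such that $\bar{E}$ is an isomorphism of Abelian groups (where $E^{ws}_{\mathbf{TA}}(A,B)$ carries the Baer sum).
   Context: $\mathbf{TA}$ is the category of topological Abelian groups (not assumed Hausdorff) and continuous homomorphisms. An extension of $B$ by $A$ in $\mathbf{TA}$ is a sequence $E=(B\xrightarrow{j}X\xrightarrow{p}A)$ in $\mathbf{TA}$ where $p$ is a surjective open continuous homomorphism and $j$ is the kernel of $p$ in $\mathbf{TA}$ (i.e. $j$ is a topological embedding with image $p^{-1}(0)$). It is a weak-split extension ($ws$-extension) if there is a continuous map $\mathbf{s}\colon A\to X$ (not necessarily a homomorphism) with $p\mathbf{s}=\mathrm{id}_A$ and $\mathbf{s}(0)=0$. $E^{ws}_{\mathbf{TA}}(A,B)$ is the set of $ws$-extensions of $B$ by $A$ modulo the equivalence relation generated by: $(B\xrightarrow{j}X\xrightarrow{p}A)\sim(B\xrightarrow{j'}X'\xrightarrow{p'}A)$ if there is a continuous homomorphism $\theta\colon X\to X'$ with $\theta j=j'$ and $p'\theta=p$. It is an Abelian group under the Baer sum $[E]+[E']=[\Delta_A^*((\nabla^B)_*(E\times E'))]$,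 where $E\times E'$ is the product extension of $B\times B$ by $A\times A$, $(\nabla^B)_*$ is pushout in $\mathbf{TA}$ along $\nabla^B(b,b')=b+b'$, and $\Delta_A^*$ is pullback along $\Delta_A(a)=(a,a)$; its base point (zero) is the class of the split extension $B\xrightarrow{i_1}B\times A\xrightarrow{p_2}A$ with the product group structure. Let $i_1\colon B\to B\times A$, $i_1(b)=(b,0)$, and $p_2\colon B\times A\to A$, $p_2(b,a)=a$. $\Sigma_{A,B}$ is the set of all continuous operations $+'\colon (B\times A)\times(B\times A)\to B\times A$ on the product space $B\times A$ such that $(B\times A,+')$ (with the product topology) is a topological Abelian group and $i_1\colon(B,+)\to(B\times A,+')$, $p_2\colon(B\times A,+')\to(A,+)$ are continuous homomorphisms. For $+',+''\in\Sigma_{A,B}$, $+'\sim+''$ means that there is a topological isomorphism $\gamma\colon(B\times A,+')\to(B\times A,+'')$ with $\gamma i_1(b)=i_1(b)$ and $p_2\gamma(b,a)=a$ for all $b\in B$, $a\in A$. The base point of $\Sigma_{A,B}/{\sim}$ is the class of the usual product sum. *)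

(* Defs.v *)
From HB Require Import structures.
From Stdlib Require Import Relations.
From mathcomp Require Import all_boot all_order all_algebra.
From mathcomp Require Import all_classical all_reals all_analysis.
Set Implicit Arguments.
Unset Strict Implicit.
Unset Printing Implicit Defensive.
Import GRing.Theory.
Local Open Scope classical_set_scope.
Local Open Scope ring_scope.
Local Open Scope quotient_scope.

Definition open_map (T U : topologicalType) (f : T -> U) :=
  forall O : set T, open O -> open (f @` O).

Definition topological_embedding (T U : topologicalType) (f : T -> U) :=
  injective f /\
  forall O : set T, open O <-> exists2 O' : set U, open O' & O = f @^-1` O'.

Section Continuity.
Context {T : topologicalType}.

Lemma cts_comp (U V : topologicalType) (f : T -> U) (g : U -> V) :
  continuous f -> continuous g -> continuous (fun x => g (f x)).
Proof. by move=> cf cg x; apply: continuous_comp; [exact: cf|exact: cg]. Qed.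

Lemma cts_open (U : topologicalType) (f : T -> U) (O : set U) :
  continuous f -> open O -> open (f @^-1` O).
Proof. by move=> /continuousP; apply. Qed.

Lemma cts_pair (U V : topologicalType) (f : T -> U) (g : T -> V) :
  continuous f -> continuous g -> continuous (fun x => (f x, g x)).
Proof. by move=> cf cg x; apply: cvg_pair => /=; [exact: cf|exact: cg]. Qed.

Lemma cts_id : continuous (fun x : T => x).
Proof. by move=> x. Qed.

Lemma cts_cst (U : topologicalType) (u : U) : continuous (fun x : T => u).
Proof. by move=> x; exact: cvg_cst. Qed.

Lemma cts_fst (U : topologicalType) : continuous (@fst T U).
Proof. by move=> x; exact: cvg_fst. Qed.

Lemma cts_snd (U : topologicalType) : continuous (@snd U T).
Proof. by move=> x; exact: cvg_snd. Qed.

Lemma cts_add (G : topologicalZmodType) (f g : T -> G) :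
  continuous f -> continuous g -> continuous (fun x => f x + g x).
Proof.
move=> cf cg.
exact: (@cts_comp _ _ (fun x => (f x, g x)) _ (cts_pair cf cg) add_continuous).
Qed.

Lemma cts_opp (G : topologicalZmodType) (f : T -> G) :
  continuous f -> continuous (fun x => - f x).
Proof. by move=> cf; exact: cts_comp cf opp_continuous. Qed.

Lemma openXP (U : topologicalType) (O : set (T * U)) (z : T * U) :
  open O -> O z -> exists V W,
    [/\ open V, open W, V z.1, W z.2 & V `*` W `<=` O].
Proof.
rewrite openE => /[apply]; case=> -[P Q] /= [].
rewrite !nbhsE => -[V [oV Vz] VP] [W [oW Wz] WQ] PQ.
by exists V, W; split=> // -[t u] [/= /VP Pt /WQ Qu]; apply: PQ.
Qed.

Lemma openXI (U : topologicalType) (V : set T) (W : set U) :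
  open V -> open W -> open (V `*` W).
Proof.
move=> oV oW; rewrite openE => -[t u] [/= Vt Wu].
by exists (V, W) => //; split; apply: open_nbhs_nbhs.
Qed.

Lemma openP (O : set T) :
  (forall x, O x -> exists V, [/\ open V, V x & V `<=` O]) -> open O.
Proof.
move=> H; rewrite openE => x /H[V [oV Vx VO]].
by apply: filterS VO _; exact: open_nbhs_nbhs.
Qed.

End Continuity.

Lemma topological_embeddingI (T U : topologicalType) (f : T -> U) :
  injective f -> continuous f ->
  (forall (O : set T) x, open O -> O x ->
     exists O', [/\ open O', O' (f x) & f @^-1` O' `<=` O]) ->
  topological_embedding f.
Proof.
move=> fI cf H; split=> // O; split=> [ oO|];
  last by move=> [V oV ->]; move/continuousP : cf; exact.
exists (\bigcup_(V in [set V | open V /\ f @^-1` V `<=` O]) V).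
  by apply: bigcup_open => V [].
apply/seteqP; split=> [x Ox|x [V [_ VO] Vx]]; last exact: VO.
by have [V [oV Vx VO]] := H _ _ oO Ox; exists V.
Qed.

(* Extensions of B by A; the last two fields say that the kernel of p in the
   category of topological Abelian groups is j. *)
Record extension (A B : topologicalZmodType) := Extension {
  ext_sort : topologicalZmodType ;
  ext_j : {additive B -> ext_sort} ;
  ext_p : {additive ext_sort -> A} ;
  ext_p_cts : continuous ext_p ;
  ext_p_surj : forall a, exists x, ext_p x = a ;
  ext_p_open : open_map ext_p ;
  ext_j_emb : topological_embedding ext_j ;
  ext_j_ker : range ext_j = ext_p @^-1` [set 0] }.

Definition weak_split A B (E : extension A B) :=
  exists s : A -> ext_sort E,
    [/\ continuous s, cancel s (ext_p E) & s 0 = 0].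

Record wsextension (A B : topologicalZmodType) := WSExtension {
  ws_ext :> extension A B ;
  ws_split : weak_split ws_ext }.

Definition ext_morph A B (E E' : extension A B) :=
  exists theta : {additive ext_sort E -> ext_sort E'},
    [/\ continuous theta,
        forall b, theta (ext_j E b) = ext_j E' b &
        forall x, ext_p E' (theta x) = ext_p E x].

Definition ws_equiv A B : wsextension A B -> wsextension A B -> Prop :=
  clos_refl_sym_trans (wsextension A B) (fun E E' => ext_morph E E').

Section ExtensionTheory.
Variables (A B : topologicalZmodType) (E : extension A B).

Lemma ext_j_inj : injective (ext_j E). Proof. by case: (ext_j_emb E). Qed.

Lemma ext_j_open (O : set B) : open O ->
  exists2 O' : set (ext_sort E), open O' & O = ext_j E @^-1` O'.
Proof. by case: (ext_j_emb E) => _ /[apply]. Qed.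

Lemma ext_j_cts : continuous (ext_j E).
Proof.
apply/continuousP => O oO; case: (ext_j_emb E) => _ H.
by apply/H; exists O.
Qed.

Lemma ext_pj b : ext_p E (ext_j E b) = 0.
Proof.
have : (ext_p E @^-1` [set 0]) (ext_j E b) by rewrite -ext_j_ker; exists b.
by [].
Qed.

Lemma ext_kerP x : ext_p E x = 0 -> exists b, ext_j E b = x.
Proof.
move=> px; have : range (ext_j E) x by rewrite ext_j_ker.
by case=> b _ <-; exists b.
Qed.

Lemma ext_ker_of (X : topologicalZmodType) (j : B -> X) (p : X -> A) :
  (forall b, p (j b) = 0) -> (forall x, p x = 0 -> exists b, j b = x) ->
  range j = p @^-1` [set 0].
Proof.
move=> pj kp; apply/seteqP; split=> [_ [b _ <-] |x /kp[b <-]]; first exact: pj.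
by exists b.
Qed.

End ExtensionTheory.

Section ProductGroup.
Variables A A' : topologicalZmodType.

Lemma pair_sub_continuous :
  continuous (fun z : (A * A') * (A * A') => z.1 - z.2).
Proof.
apply: (@cts_pair _ _ _ (fun z : (A * A') * (A * A') => z.1.1 - z.2.1)
  (fun z : (A * A') * (A * A') => z.1.2 - z.2.2)).
all: apply: cts_add; last apply: cts_opp.
- exact: cts_comp (@cts_fst _ _) (@cts_fst _ _).
- exact: cts_comp (@cts_snd _ _) (@cts_fst _ _).
- exact: cts_comp (@cts_fst _ _) (@cts_snd _ _).
- exact: cts_comp (@cts_snd _ _) (@cts_snd _ _).
Qed.

(* Not declared canonical: the library's canonical structure on a product is
   restricted to topological vector spaces. *)
Definition prodG : topologicalZmodType :=
  HB.pack_for topologicalZmodType (A * A')%type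
    (PreTopologicalNmodule_isTopologicalZmodule.Build (A * A')%type
       pair_sub_continuous).

End ProductGroup.
Lemma morphD_morphB (U V : zmodType) (f : U -> V) :
  {morph f : x y / x + y >-> x + y} -> {morph f : x y / x - y >-> x - y}.
Proof. by move=> fD x y; apply/eqP; rewrite -subr_eq opprK -fD subrK. Qed.

Definition add_hom (U V : zmodType) (f : U -> V)
    (fD : {morph f : x y / x + y >-> x + y}) : {additive U -> V} :=
  HB.pack_for {additive U -> V} f
    (GRing.isZmodMorphism.Build U V f (morphD_morphB fD)).

Section ProductExtension.
Variables (A B A' B' : topologicalZmodType).
Variables (E : extension A B) (E' : extension A' B').
Let X := prodG (ext_sort E) (ext_sort E').

Definition prod_j (b : prodG B B') : X := (ext_j E b.1, ext_j E' b.2).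
Definition prod_p (x : X) : prodG A A' := (ext_p E x.1, ext_p E' x.2).

Lemma prod_jD : {morph prod_j : x y / x + y >-> x + y}.
Proof. by move=> x y; rewrite /prod_j !raddfD. Qed.

Lemma prod_pD : {morph prod_p : x y / x + y >-> x + y}.
Proof. by move=> x y; rewrite /prod_p !raddfD. Qed.

Lemma prod_j_cts : continuous prod_j.
Proof.
apply: (@cts_pair _ _ _ (fun b : B * B' => ext_j E b.1)
  (fun b : B * B' => ext_j E' b.2)).
  exact: cts_comp (@cts_fst _ _) (@ext_j_cts _ _ E).
exact: cts_comp (@cts_snd _ _) (@ext_j_cts _ _ E').
Qed.

Lemma prod_p_cts : continuous prod_p.
Proof.
apply: (@cts_pair _ _ _ (fun b : ext_sort E * ext_sort E' => ext_p E b.1)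
  (fun b : ext_sort E * ext_sort E' => ext_p E' b.2)).
  exact: cts_comp (@cts_fst _ _) (@ext_p_cts _ _ E).
exact: cts_comp (@cts_snd _ _) (@ext_p_cts _ _ E').
Qed.

Lemma prod_p_surj a : exists x, prod_p x = a.
Proof.
case: a => a a'; have [x <-] := ext_p_surj E a.
by have [x' <-] := ext_p_surj E' a'; exists (x, x').
Qed.

Lemma prod_p_open : open_map prod_p.
Proof.
move=> O oO; apply: openP => _ [x Ox <-].
have [V [W [oV oW Vx Wx VW]]] := openXP oO Ox.
exists ((ext_p E @` V) `*` (ext_p E' @` W)); split.
- by apply: openXI; apply: ext_p_open.
- by split; [exists x.1|exists x.2].
- by move=> [_ _] [/= [v Vv <-] [w Ww <-]]; exists (v, w) => //; apply: VW.
Qed.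

Lemma prod_j_emb : topological_embedding prod_j.
Proof.
apply: topological_embeddingI prod_j_cts _.
  by move=> [b b'] [c c'] [/ext_j_inj -> /ext_j_inj ->].
move=> O x oO Ox; have [V [W [oV oW Vx Wx VW]]] := openXP oO Ox.
have [V' oV' VE] := ext_j_open E oV; have [W' oW' WE] := ext_j_open E' oW.
exists (V' `*` W'); split; first exact: openXI.
  by move: Vx Wx; rewrite VE WE.
by move=> [b b'] [/= Vb Wb]; apply: VW; rewrite VE WE.
Qed.

Lemma prod_j_ker : range prod_j = prod_p @^-1` [set 0].
Proof.
apply: ext_ker_of => [b|[x x'] [/ext_kerP[b <-] /ext_kerP[b' <-]]].
  by rewrite /prod_p /= !ext_pj.
by exists (b, b').
Qed.

Definition prod_ext : extension (prodG A A') (prodG B B') :=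
  @Extension (prodG A A') (prodG B B') X (add_hom prod_jD) (add_hom prod_pD)
    prod_p_cts prod_p_surj prod_p_open prod_j_emb prod_j_ker.

Lemma prod_ws : weak_split E -> weak_split E' -> weak_split prod_ext.
Proof.
move=> [s [cs sK s0]] [s' [cs' sK' s0']].
exists (fun a : prodG A A' => (s a.1, s' a.2) : X); split.
- apply: (@cts_pair _ _ _ (fun b : A * A' => s b.1) (fun b : A * A' => s' b.2)).
    exact: cts_comp (@cts_fst _ _) cs.
  exact: cts_comp (@cts_snd _ _) cs'.
- by move=> [a a'] /=; rewrite /prod_p /= sK sK'.
- by rewrite /= s0 s0'.
Qed.

End ProductExtension.

Section Pullback.
Variables (A B A' : topologicalZmodType) (E : extension A B).
Variables (g : {additive A' -> A}) (g_cts : continuous g).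

Definition pullback_set : set (ext_sort E * A') :=
  [set z | ext_p E z.1 = g z.2].

Definition pullback_type : Type := set_type pullback_set.

HB.instance Definition _ := Topological.on pullback_type.

Let val_ (y : pullback_type) : ext_sort E * A' := \val y.

Definition pullback_mk (z : ext_sort E * A') (h : pullback_set z) :
  pullback_type := exist _ z (mem_set h).

Lemma pullbackP (y : pullback_type) : ext_p E (\val y).1 = g (\val y).2.
Proof. by case: y => z /= /set_mem. Qed.

Lemma pullback_add_subproof (x y : pullback_type) :
  pullback_set (\val x + \val y).
Proof. by rewrite /pullback_set /= !raddfD /= !pullbackP. Qed.

Lemma pullback_opp_subproof (x : pullback_type) : pullback_set (- \val x).
Proof. by rewrite /pullback_set /= !raddfN /= pullbackP. Qed.

Lemma pullback_zero_subproof : pullback_set 0.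
Proof. by rewrite /pullback_set /= !raddf0. Qed.

Definition pullback_add x y := pullback_mk (pullback_add_subproof x y).
Definition pullback_opp x := pullback_mk (pullback_opp_subproof x).
Definition pullback_zero := pullback_mk pullback_zero_subproof.

Let addA : associative pullback_add.
Proof. by move=> x y z; apply: val_inj; rewrite /= addrA. Qed.
Let addC : commutative pullback_add.
Proof. by move=> x y; apply: val_inj; rewrite /= addrC. Qed.
Let add0 : left_id pullback_zero pullback_add.
Proof. by move=> x; apply: val_inj; rewrite /= add0r. Qed.
Let addN : left_inverse pullback_zero pullback_opp pullback_add.
Proof. by move=> x; apply: val_inj; rewrite /= addNr. Qed.

HB.instance Definition _ :=
  GRing.isZmodule.Build pullback_type addA addC add0 addN.

Lemma pullback_val_cts : continuous (\val : pullback_type -> ext_sort E * A').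
Proof. exact: initial_continuous. Qed.

Lemma pullback_ctsP (T : topologicalType) (f : T -> pullback_type) :
  continuous (fun x => \val (f x)) -> continuous f.
Proof.
move=> /continuousP cf; apply/continuousP => _ [W oW <-]; exact: cf.
Qed.

Lemma pullback_sub_cts :
  continuous (fun z : pullback_type * pullback_type => z.1 - z.2).
Proof.
apply: pullback_ctsP => /=.
have c1 := cts_comp (@cts_fst pullback_type pullback_type) pullback_val_cts.
have c2 := cts_comp (@cts_snd pullback_type pullback_type) pullback_val_cts.
exact: (@cts_add _ (prodG (ext_sort E) A') _ _ c1
  (@cts_opp _ (prodG (ext_sort E) A') _ c2)).
Qed.

HB.instance Definition _ :=
  PreTopologicalNmodule_isTopologicalZmodule.Build pullback_type
    pullback_sub_cts.

Lemma pullback_j_subproof b : pullback_set (ext_j E b, 0).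
Proof. by rewrite /pullback_set /= ext_pj raddf0. Qed.

Definition pullback_j (b : B) : pullback_type :=
  pullback_mk (pullback_j_subproof b).
Definition pullback_p (y : pullback_type) : A' := (\val y).2.

Lemma pullback_jD : {morph pullback_j : x y / x + y >-> x + y}.
Proof.
move=> x y; apply: val_inj => /=; rewrite raddfD.
by congr (_, _); rewrite addr0.
Qed.

Lemma pullback_pD : {morph pullback_p : x y / x + y >-> x + y}.
Proof. by []. Qed.

Lemma pullback_j_cts : continuous pullback_j.
Proof.
apply: pullback_ctsP; apply: cts_pair; first exact: ext_j_cts.
exact: cts_cst.
Qed.

Lemma pullback_p_cts : continuous pullback_p.
Proof. exact: cts_comp pullback_val_cts (@cts_snd _ _). Qed.

Lemma pullback_p_surj a : exists x, pullback_p x = a.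
Proof.
have [x xa] := ext_p_surj E (g a).
by exists (@pullback_mk (x, a) xa).
Qed.

Lemma pullback_p_open : open_map pullback_p.
Proof.
move=> _ [U oU <-]; apply: openP => _ [y /= Uy <-].
have [V [W [oV oW Vy Wy VW]]] := openXP oU Uy.
exists (g @^-1` (ext_p E @` V) `&` W); split.
- apply: openI => //; move/continuousP: g_cts; apply; exact: ext_p_open.
- by split=> //; exists (\val y).1 => //; exact: pullbackP.
- move=> a [[v Vv va] Wa]; exists (@pullback_mk (v, a) va) => //.
  exact: VW.
Qed.

Lemma pullback_j_emb : topological_embedding pullback_j.
Proof.
apply: topological_embeddingI pullback_j_cts _.
  by move=> b c /(congr1 val) /= [/ext_j_inj].
move=> V b oV Vb; have [V' oV' VE] := ext_j_open E oV.
exists (val @^-1` (V' `*` setT)); split.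
- by exists (V' `*` setT) => //; apply: openXI => //; exact: openT.
- by split=> //; move: Vb; rewrite VE.
- by move=> c [/= Vc _]; rewrite VE.
Qed.

Lemma pullback_j_ker : range pullback_j = pullback_p @^-1` [set 0].
Proof.
apply: ext_ker_of => // -[[x a] xa]; rewrite /pullback_p /= => a0.
have /ext_kerP[b bx] : ext_p E x = 0.
  by move/set_mem: (xa); rewrite /pullback_set /= a0 raddf0.
by exists b; apply: val_inj; rewrite /= bx a0.
Qed.

Definition pullback_ext : extension A' B :=
  @Extension A' B pullback_type (add_hom pullback_jD) (add_hom pullback_pD)
    pullback_p_cts pullback_p_surj pullback_p_open pullback_j_emb
    pullback_j_ker.

Lemma pullback_ws : weak_split E -> weak_split pullback_ext.
Proof.
move=> [s [cs sK s0]].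
exists (fun a => @pullback_mk (s (g a), a) (sK (g a))); split=> //.
  apply: pullback_ctsP; apply: cts_pair; last exact: cts_id.
  exact: cts_comp g_cts cs.
by apply: val_inj; rewrite /= raddf0 s0.
Qed.

End Pullback.

(* The pushout of B -> X along f : B -> B' is the quotient of B' * X by the
   subgroup of all (f b, - j b), with the quotient topology. *)
Section Pushout.
Variables (A B B' : topologicalZmodType) (E : extension A B).
Variables (f : {additive B -> B'}) (f_cts : continuous f).
Let V := prodG B' (ext_sort E).

Definition pushout_rel : {pred V} :=
  fun z => `[< exists b, z = (f b, - ext_j E b) >].

Lemma pushout_relP (z : V) :
  reflect (exists b, z = (f b, - ext_j E b)) (z \in pushout_rel).
Proof. exact: asboolP. Qed.

Lemma pushout_rel_closed : zmod_closed pushout_rel.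
Proof.
split=> [|x y]; first by apply/pushout_relP; exists 0; rewrite !raddf0.
move=> /pushout_relP[b ->] /pushout_relP[c ->]; apply/pushout_relP.
by exists (b - c); rewrite !raddfB /=; congr (_, _).
Qed.

HB.instance Definition _ :=
  GRing.isZmodClosed.Build V pushout_rel pushout_rel_closed.

Definition pushout_type : Type := quotient_topology {ideal_quot pushout_rel}.


HB.instance Definition _ := Topological.on pushout_type.
HB.instance Definition _ := Quotient.on pushout_type.

Definition pushout_pi : V -> pushout_type := \pi_pushout_type.

Lemma pushout_piP (z w : V) :
  pushout_pi z = pushout_pi w <-> exists b, z - w = (f b, - ext_j E b).
Proof.
have := ring_quotient.Quotient.idealrBE pushout_rel z w.
move=> H; split=> [zw|H'].
  by apply/pushout_relP; rewrite H; apply/eqP.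
suff : z == w %[mod {ideal_quot pushout_rel}] by move/eqP.
by rewrite -H; apply/pushout_relP.
Qed.

Lemma pushout_reprK x : pushout_pi (repr x) = x.
Proof. exact: reprK. Qed.

Let Q : zmodType := {ideal_quot pushout_rel}.
HB.instance Definition _ := GRing.isZmodule.Build pushout_type
  (@addrA Q) (@addrC Q) (@add0r Q) (@addNr Q).

Lemma pushout_piD : {morph pushout_pi : x y / x + y >-> x + y}.
Proof.
by move=> x y; exact: (@ring_quotient.Quotient.pi_add _ pushout_rel).
Qed.

Lemma pushout_pi_cts : continuous pushout_pi.
Proof. exact: pi_continuous. Qed.

Lemma pushout_ctsP (Z : topologicalType) (h : pushout_type -> Z) :
  continuous (fun z => h (pushout_pi z)) -> continuous h.
Proof. by move=> ch; apply/quotient_continuous. Qed.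

Lemma pushout_openP (O : set pushout_type) :
  open (pushout_pi @^-1` O) -> open O.
Proof. by []. Qed.

Lemma pushout_pi_open : open_map pushout_pi.
Proof.
move=> O oO; apply: pushout_openP.
rewrite (_ : _ @^-1` _ = \bigcup_(b in [set: B])
    ((fun z : V => z + (f b, - ext_j E b)) @^-1` O)).
  apply: bigcup_open => b _; move: O oO; apply/continuousP.
  exact: (@cts_add _ V _ _ (@cts_id _) (@cts_cst _ _ _)).
apply/seteqP; split=> [z [w Ow /pushout_piP[b bE]]|z [b _ /= Ob]].
  by exists b => //=; rewrite -bE addrCA subrr addr0.
exists (z + (f b, - ext_j E b)) => //; apply/pushout_piP; exists b.
by rewrite addrAC subrr add0r.
Qed.

Lemma pushout_sub_cts :
  continuous (fun z : pushout_type * pushout_type => z.1 - z.2).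
Proof.
apply/continuousP => O oO; apply: openP => -[x y] /=.
rewrite -(pushout_reprK x) -(pushout_reprK y).
move: (repr x) (repr y) => z w Ozw.
have cs : continuous (fun t : V * V => pushout_pi (t.1 - t.2)).
  by apply: cts_comp pushout_pi_cts; exact: pair_sub_continuous.
have oO' := cts_open cs oO.
have piB a b : pushout_pi (a - b) = pushout_pi a - pushout_pi b.
  exact: morphD_morphB pushout_piD a b.
have Ozw' : O (pushout_pi ((z, w).1 - (z, w).2)) by rewrite /= piB.
have [P [R [oP oR Pz Rw PR]]] := openXP oO' Ozw'.
exists ((pushout_pi @` P) `*` (pushout_pi @` R)); split.
- by apply: openXI; exact: pushout_pi_open.
- by split; [exists z|exists w].
- move=> [_ _] [/= [a Pa <-] [b Rb <-]]; rewrite -piB.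
  exact: (PR (a, b)).
Qed.

HB.instance Definition _ :=
  PreTopologicalNmodule_isTopologicalZmodule.Build pushout_type pushout_sub_cts.

Definition pushout_j (b : B') : pushout_type := pushout_pi (b, 0).
Definition pushout_p (x : pushout_type) : A := ext_p E (repr x).2.

Lemma pushout_pE z : pushout_p (pushout_pi z) = ext_p E z.2.
Proof.
have /pushout_piP[b bE] := pushout_reprK (pushout_pi z).
apply/eqP; rewrite -subr_eq0 -raddfB.
by rewrite (_ : _ - _ = - ext_j E b) ?raddfN ?ext_pj ?oppr0 //; case: bE.
Qed.

Lemma pushout_jD : {morph pushout_j : x y / x + y >-> x + y}.
Proof.
move=> x y; rewrite /pushout_j -pushout_piD; congr pushout_pi.
by congr (_, _); rewrite addr0.
Qed.

Lemma pushout_pD : {morph pushout_p : x y / x + y >-> x + y}.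
Proof.
move=> x y; rewrite -(pushout_reprK x) -(pushout_reprK y) -pushout_piD.
by rewrite !pushout_pE raddfD.
Qed.

Lemma pushout_j_cts : continuous pushout_j.
Proof.
apply: (@cts_comp _ _ _ (fun b : B' => (b, 0 : ext_sort E))) pushout_pi_cts.
by apply: cts_pair; [exact: cts_id|exact: cts_cst].
Qed.

Lemma pushout_p_cts : continuous pushout_p.
Proof.
apply: pushout_ctsP.
rewrite (_ : (fun z => _) = fun z : V => ext_p E z.2); last first.
  by apply/funext => z; exact: pushout_pE.
exact: cts_comp (@cts_snd _ _) (@ext_p_cts _ _ E).
Qed.

Lemma pushout_p_surj a : exists x, pushout_p x = a.
Proof.
have [x <-] := ext_p_surj E a.
by exists (pushout_pi (0, x)); rewrite pushout_pE.
Qed.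

Lemma pushout_p_open : open_map pushout_p.
Proof.
move=> O oO.
rewrite (_ : _ @` _ = ext_p E @` (snd @` (pushout_pi @^-1` O))).
  apply: ext_p_open; apply: snd_open.
  exact: cts_open pushout_pi_cts oO.
apply/seteqP; split=> [_ [x Ox <-]|_ [_ [z Oz <-] <-]].
  by exists (repr x).2 => //; exists (repr x) => //=; rewrite pushout_reprK.
by exists (pushout_pi z) => //; rewrite pushout_pE.
Qed.

Lemma pushout_j_emb : topological_embedding pushout_j.
Proof.
apply: topological_embeddingI pushout_j_cts _.
  move=> b c /pushout_piP[d [bc jd]].
  have d0 : d = 0.
    apply: (@ext_j_inj _ _ E); rewrite raddf0; apply: oppr_inj.
    by rewrite -jd subrr oppr0.
  by apply/eqP; rewrite -subr_eq0 bc d0 raddf0.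
move=> O b oO Ob.
have Ob0 : O ((b, 0 : B').1 + (b, 0 : B').2) by rewrite /= addr0.
have [P [R [oP oR Pb R0 PR]]] := openXP (z := (b, 0))
  (cts_open (@add_continuous B') oO) Ob0.
have oR' := cts_open f_cts oR.
have [W oW WE] := ext_j_open E oR'.
exists (pushout_pi @` (P `*` W)); split.
- by apply: pushout_pi_open; exact: openXI.
- exists (b, 0) => //; split=> //=.
  suff : (f @^-1` R) 0 by rewrite WE /= raddf0.
  by rewrite /= raddf0.
- move=> c [[u v] /= [Pu Wv] /pushout_piP[d [ud vd]]].
  have -> : c = u - f d by rewrite -ud opprB addrC subrK.
  apply: (PR (u, - f d)); split=> //=.
  suff : (f @^-1` R) (- d) by rewrite /= raddfN.
  by rewrite WE /= raddfN -vd subr0.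
Qed.

Lemma pushout_j_ker : range pushout_j = pushout_p @^-1` [set 0].
Proof.
apply: ext_ker_of => [b|x]; first by rewrite pushout_pE raddf0.
rewrite -(pushout_reprK x) pushout_pE => /ext_kerP[b bE].
exists ((repr x).1 + f b); apply/pushout_piP; exists b.
by rewrite [repr x]surjective_pairing; congr (_, _);
  rewrite /= ?bE ?sub0r // addrAC subrr add0r.
Qed.

Definition pushout_ext : extension A B' :=
  @Extension A B' pushout_type (add_hom pushout_jD) (add_hom pushout_pD)
    pushout_p_cts pushout_p_surj pushout_p_open pushout_j_emb pushout_j_ker.

Lemma pushout_ws : weak_split E -> weak_split pushout_ext.
Proof.
move=> [s [cs sK s0]]; exists (fun a => pushout_pi (0, s a)); split.
- apply: (@cts_comp _ _ _ (fun a : A => (0 : B', s a))) pushout_pi_cts.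
  by apply: cts_pair; first exact: cts_cst.
- by move=> a /=; rewrite pushout_pE /= sK.
- by rewrite s0; exact: (raddf0 (add_hom pushout_piD)).
Qed.

Lemma pushout_univ (Z : topologicalZmodType) (h : {additive B' -> Z})
    (k : {additive ext_sort E -> Z}) :
  continuous h -> continuous k -> (forall b, h (f b) = k (ext_j E b)) ->
  exists! u : pushout_type -> Z,
    [/\ {morph u : x y / x + y >-> x + y}, continuous u,
        forall b, u (pushout_j b) = h b &
        forall x, u (pushout_pi (0, x)) = k x].
Proof.
move=> ch ck hk; pose u (x : pushout_type) := h (repr x).1 + k (repr x).2.
have uE z : u (pushout_pi z) = h z.1 + k z.2.
  have /pushout_piP[b bE] := pushout_reprK (pushout_pi z).
  have b1 : (repr (pushout_pi z)).1 - z.1 = f b := congr1 fst bE.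
  have b2 : (repr (pushout_pi z)).2 - z.2 = - ext_j E b := congr1 snd bE.
  apply/eqP; rewrite /u -subr_eq0 opprD addrACA -(raddfB h) -(raddfB k) b1 b2.
  by rewrite hk raddfN subrr.
exists u; split.
  split.
  - move=> x y; rewrite -(pushout_reprK x) -(pushout_reprK y) -pushout_piD !uE.
    by rewrite !raddfD addrACA.
  - apply: pushout_ctsP.
    rewrite (_ : (fun z => _) = fun z : V => h z.1 + k z.2); last first.
      by apply/funext => z; exact: uE.
    by apply: cts_add; [exact: cts_comp (@cts_fst _ _) ch
                       |exact: cts_comp (@cts_snd _ _) ck].
  - by move=> b; rewrite uE raddf0 addr0.
  - by move=> x; rewrite uE raddf0 add0r.
move=> v [vD _ vj vx]; apply/funext => x.
rewrite -(pushout_reprK x) uE -vj -vx -vD -pushout_piD.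
congr (v (pushout_pi _)).
by rewrite [RHS]surjective_pairing; congr (_, _); rewrite /= ?addr0 ?add0r.
Qed.

End Pushout.

Section BaerSum.
Variables A B : topologicalZmodType.

Definition codiag (b : prodG B B) : B := b.1 + b.2.
Definition diag (a : A) : prodG A A := (a, a).

Lemma codiagD : {morph codiag : x y / x + y >-> x + y}.
Proof. by move=> x y; rewrite /codiag /= addrACA. Qed.

Lemma diagD : {morph diag : x y / x + y >-> x + y}.
Proof. by []. Qed.

Lemma codiag_cts : continuous codiag.
Proof. exact: add_continuous. Qed.

Lemma diag_cts : continuous diag.
Proof. exact: cts_pair (@cts_id _) (@cts_id _). Qed.

Definition baer_ext (E E' : extension A B) : extension A B :=
  @pullback_ext _ _ _
    (@pushout_ext _ _ _ (prod_ext E E') (add_hom codiagD) codiag_cts)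
    (add_hom diagD) diag_cts.

Lemma baer_ws (E E' : wsextension A B) : weak_split (baer_ext E E').
Proof.
apply: pullback_ws; apply: pushout_ws.
by apply: prod_ws; exact: ws_split.
Qed.

Definition baer (E E' : wsextension A B) : wsextension A B :=
  WSExtension (baer_ws E E').

End BaerSum.

Lemma ext_morph_refl A B (E : extension A B) : ext_morph E E.
Proof. by exists idfun; split=> //; exact: cts_id. Qed.

Lemma prod_morph (A B A' B' : topologicalZmodType)
    (E E1 : extension A B) (E' E1' : extension A' B') :
  ext_morph E E1 -> ext_morph E' E1' ->
  ext_morph (prod_ext E E') (prod_ext E1 E1').
Proof.
move=> [t [ct tj tp]] [t' [ct' tj' tp']].
pose u (x : ext_sort (prod_ext E E')) : ext_sort (prod_ext E1 E1') :=
  (t x.1, t' x.2).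
have uD : {morph u : x y / x + y >-> x + y}.
  by move=> x y; rewrite /u !raddfD.
exists (add_hom uD); split.
- apply: (@cts_pair _ _ _ (fun x : ext_sort E * ext_sort E' => t x.1)
    (fun x : ext_sort E * ext_sort E' => t' x.2)).
    exact: cts_comp (@cts_fst _ _) ct.
  exact: cts_comp (@cts_snd _ _) ct'.
- by move=> b; rewrite /= /u /= tj tj'.
- by move=> x; rewrite /= /prod_p /= tp tp'.
Qed.

Lemma pullback_morph (A B A' : topologicalZmodType)
    (E E' : extension A B) (g : {additive A' -> A})
    (g_cts : continuous g) :
  ext_morph E E' -> ext_morph (pullback_ext E g_cts) (pullback_ext E' g_cts).
Proof.
move=> [t [ct tj tp]].
have us (y : pullback_type E g) :
    @pullback_set _ _ _ E' g (t (\val y).1, (\val y).2).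
  by rewrite /pullback_set /= tp pullbackP.
pose u (y : pullback_type E g) : pullback_type E' g := pullback_mk (us y).
have uD : {morph u : x y / x + y >-> x + y}.
  by move=> x y; apply: val_inj; rewrite /= raddfD.
exists (add_hom uD); split.
- apply: pullback_ctsP; apply: cts_pair.
    by apply: cts_comp ct; apply: cts_comp (@cts_fst _ _);
      exact: pullback_val_cts.
  by apply: cts_comp (@cts_snd _ _); exact: pullback_val_cts.
- by move=> b; apply: val_inj; rewrite /= tj.
- by [].
Qed.

Lemma pushout_morph (A B B' : topologicalZmodType)
    (E E' : extension A B) (f : {additive B -> B'})
    (f_cts : continuous f) :
  ext_morph E E' -> ext_morph (pushout_ext E f_cts) (pushout_ext E' f_cts).
Proof.
move=> [t [ct tj tp]].
pose u (x : pushout_type E f) : pushout_type E' f :=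
  pushout_pi f ((repr x).1, t (repr x).2).
have uE z : u (pushout_pi f z) = pushout_pi f (z.1, t z.2).
  have /pushout_piP[b bE] := pushout_reprK (pushout_pi f z).
  apply/pushout_piP; exists b; case: bE => b1 b2.
  by congr (_, _) => //=; rewrite -raddfB b2 raddfN tj.
have uD : {morph u : x y / x + y >-> x + y}.
  move=> x y; rewrite -(pushout_reprK x) -(pushout_reprK y) -pushout_piD !uE.
  by rewrite -pushout_piD /= raddfD.
exists (add_hom uD); split.
- apply: pushout_ctsP.
  rewrite (_ : (fun z => _) = fun z => pushout_pi f (z.1, t z.2)); last first.
    by apply/funext => z; exact: uE.
  apply: (@cts_comp _ _ _ (fun z : B' * ext_sort E => (z.1, t z.2)))
    (@pushout_pi_cts _ _ _ E' f).
  apply: cts_pair; first exact: cts_fst.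
  exact: cts_comp (@cts_snd _ _) ct.
- by move=> b; rewrite /= /pushout_j uE /= raddf0.
- move=> x; rewrite -(pushout_reprK x) /= uE !pushout_pE.
  by rewrite /= tp.
Qed.

Lemma baer_morph A B (E E1 E' E1' : wsextension A B) :
  ext_morph E E1 -> ext_morph E' E1' ->
  ext_morph (baer E E') (baer E1 E1').
Proof.
by move=> m m'; apply: pullback_morph; apply: pushout_morph; exact: prod_morph.
Qed.

Lemma ws_equiv_baer A B (E E1 E' E1' : wsextension A B) :
  ws_equiv E E1 -> ws_equiv E' E1' -> ws_equiv (baer E E') (baer E1 E1').
Proof.
move=> m m'; apply: (@rst_trans _ _ _ (baer E1 E')).
  elim: m => [x y xy|x|x y _ IH|x y z _ xy _ yz].
  - by apply: rst_step; apply: baer_morph xy _; exact: ext_morph_refl.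
  - exact: rst_refl.
  - exact: rst_sym.
  - exact: rst_trans yz.
elim: m' => [x y xy|x|x y _ IH|x y z _ xy _ yz].
- by apply: rst_step; apply: baer_morph xy; exact: ext_morph_refl.
- exact: rst_refl.
- exact: rst_sym.
- exact: rst_trans yz.
Qed.

(* The library's {eq_quot _} needs a choiceType, which for universe reasons
   the type of all extensions cannot be; a class is therefore a predicate. *)
Record classes (T : Type) (R : T -> T -> Prop) := Classes {
  class_pred : T -> Prop ;
  class_predP : exists x, class_pred = R x }.

Section ClassesTheory.
Variables (T : Type) (R : T -> T -> Prop).
Hypothesis Rrefl : forall x, R x x.
Hypothesis Rsym : forall x y, R x y -> R y x.
Hypothesis Rtrans : forall x y z, R x y -> R y z -> R x z.

Definition class (x : T) : classes R := Classes (ex_intro _ x erefl).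

Definition class_repr (c : classes R) : T := projT1 (cid (class_predP c)).

Lemma class_eqP x y : class x = class y <-> R x y.
Proof.
split=> [/(congr1 (@class_pred _ _)) /= -> //|xy].
have E : R x = R y.
  by apply/funext => z; apply/propext; split; apply: Rtrans => //; exact: Rsym.
by rewrite /class; move: (ex_intro _ x _); rewrite E => h; congr Classes.
Qed.

Lemma class_reprK c : class (class_repr c) = c.
Proof.
case: c => C CP; rewrite /class_repr /=; case: cid => x /= xE; subst C.
by congr Classes.
Qed.

End ClassesTheory.

Section Classes.
Variables A B : topologicalZmodType.

Definition Ews := classes (@ws_equiv A B).

Definition ws_class (E : wsextension A B) : Ews := class (@ws_equiv A B) E.

Lemma ws_classP E E' : ws_class E = ws_class E' <-> ws_equiv E E'.
Proof.
apply: class_eqP; [exact: rst_refl|exact: rst_sym|exact: rst_trans].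
Qed.

Lemma ws_class_reprK (x : Ews) : ws_class (class_repr x) = x.
Proof. exact: class_reprK. Qed.

Definition baer_add (x y : Ews) : Ews :=
  ws_class (baer (class_repr x) (class_repr y)).

Lemma baer_addE E E' :
  baer_add (ws_class E) (ws_class E') = ws_class (baer E E').
Proof.
apply/ws_classP; apply: ws_equiv_baer;
  apply/ws_classP; exact: ws_class_reprK.
Qed.

End Classes.

Definition topological_abelian_group (T : topologicalType)
    (op : T -> T -> T) (zero : T) (opp : T -> T) :=
  [/\ associative op, commutative op, left_id zero op &
      left_inverse zero opp op]
  /\ continuous (fun z : T * T => op z.1 z.2) /\ continuous opp.

Definition continuous_hom (T U : topologicalType) (opT : T -> T -> T)
    (opU : U -> U -> U) (f : T -> U) :=
  {morph f : x y / opT x y >-> opU x y} /\ continuous f.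

Section Sigma.
Variables A B : topologicalZmodType.

Definition i1 (b : B) : B * A := (b, 0).
Definition p2 (x : B * A) : A := x.2.

Record Sigma := MkSigma {
  sum_op :> B * A -> B * A -> B * A ;
  sum_group : exists zero opp, topological_abelian_group sum_op zero opp ;
  sum_i1 : continuous_hom +%R sum_op i1 ;
  sum_p2 : continuous_hom sum_op +%R p2 }.

Definition Sigma_sim (s t : Sigma) :=
  exists gamma delta : B * A -> B * A,
    [/\ cancel gamma delta, cancel delta gamma,
        continuous_hom s t gamma & continuous_hom t s delta] /\
    (forall b, gamma (i1 b) = i1 b) /\ (forall b a, p2 (gamma (b, a)) = a).

(* An alias of B * A, so that its group law is s and not the componentwise
   one. *)
Definition sum_type (s : Sigma) : Type := (B * A)%type.

Section SumGroup.
Variable s : Sigma.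

Let zero := projT1 (cid (sum_group s)).
Let zeroP := projT2 (cid (sum_group s)).
Let opp := projT1 (cid zeroP).
Let oppP : topological_abelian_group s zero opp := projT2 (cid zeroP).

Let sumA : associative s. Proof. by case: oppP => -[]. Qed.
Let sumC : commutative s. Proof. by case: oppP => -[]. Qed.
Let sum0 : left_id zero s. Proof. by case: oppP => -[]. Qed.
Let sumN : left_inverse zero opp s. Proof. by case: oppP => -[]. Qed.

HB.instance Definition _ := Topological.copy (sum_type s) (B * A)%type.
HB.instance Definition _ :=
  GRing.isZmodule.Build (sum_type s) sumA sumC sum0 sumN.

Lemma sum_add_cts :
  continuous (fun z : sum_type s * sum_type s => z.1 + z.2).
Proof. by case: oppP => _ []. Qed.

Lemma sum_opp_cts : continuous (-%R : sum_type s -> sum_type s).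
Proof. by case: oppP => _ []. Qed.

HB.instance Definition _ :=
  PreTopologicalNmodule_isTopologicalNmodule.Build (sum_type s) sum_add_cts.
HB.instance Definition _ :=
  TopologicalNmodule_isTopologicalZmodule.Build (sum_type s) sum_opp_cts.

Definition sum_j (b : B) : sum_type s := i1 b.
Definition sum_p (x : sum_type s) : A := p2 x.

Lemma sum_jD : {morph sum_j : x y / x + y >-> x + y}.
Proof. by case: (sum_i1 s). Qed.

Lemma sum_pD : {morph sum_p : x y / x + y >-> x + y}.
Proof. by case: (sum_p2 s). Qed.

Lemma i1_cts : continuous i1.
Proof. exact: cts_pair (@cts_id _) (@cts_cst _ _ _). Qed.

Lemma sum_p_surj a : exists x, sum_p x = a.
Proof. by exists (0, a). Qed.

Lemma sum_p_open : open_map sum_p.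
Proof. exact: snd_open. Qed.

Lemma sum_j_emb : topological_embedding sum_j.
Proof.
apply: topological_embeddingI i1_cts _; first by move=> b c [].
move=> O b oO Ob; exists (O `*` setT); split=> //.
  exact: openXI oO openT.
by move=> c [].
Qed.

Lemma sum_j_ker : range sum_j = sum_p @^-1` [set 0].
Proof. by apply: ext_ker_of => // -[b a] a0; exists b; rewrite (_ : a = 0). Qed.

Definition sum_ext : extension A B :=
  @Extension A B (sum_type s) (add_hom sum_jD) (add_hom sum_pD)
    (@cts_snd _ _) sum_p_surj sum_p_open sum_j_emb sum_j_ker.

Lemma sum_ws : weak_split sum_ext.
Proof.
exists (fun a => (0, a) : sum_type s); split=> //.
  exact: cts_pair (@cts_cst _ _ _) (@cts_id _).
exact: (raddf0 (add_hom sum_jD)).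
Qed.

Definition E_sum : wsextension A B := WSExtension sum_ws.

End SumGroup.

Lemma Sigma_sim_refl s : Sigma_sim s s.
Proof. by exists idfun, idfun; do ! split=> //; exact: cts_id. Qed.

Lemma Sigma_sim_sym s t : Sigma_sim s t -> Sigma_sim t s.
Proof.
move=> [g [d [[gK dK gh dh] [gi gp]]]]; exists d, g; split=> //.
split=> [b|b a]; first by rewrite -{1}gi gK.
by have := gp (d (b, a)).1 (d (b, a)).2; rewrite -surjective_pairing dK.
Qed.

Lemma Sigma_sim_trans s t u : Sigma_sim s t -> Sigma_sim t u -> Sigma_sim s u.
Proof.
move=> [g [d [[gK dK [gM cg] [dM cd]] [gi gp]]]].
move=> [g' [d' [[gK' dK' [gM' cg'] [dM' cd']] [gi' gp']]]].
exists (g' \o g), (d \o d'); split; first split.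
- exact: can_comp.
- exact: can_comp.
- by split=> [x y|]; [rewrite /= gM gM'|exact: cts_comp cg cg'].
- by split=> [x y|]; [rewrite /= dM' dM|exact: cts_comp cd' cd].
split=> [b|b a] /=; first by rewrite gi gi'.
rewrite -[RHS](gp b a).
by have := gp' (g (b, a)).1 (g (b, a)).2; rewrite -surjective_pairing.
Qed.

End Sigma.

Section SigmaClasses.
Variables A B : topologicalZmodType.

Definition SigmaQ := classes (@Sigma_sim A B).

Definition Sigma_class (s : Sigma A B) : SigmaQ := class (@Sigma_sim A B) s.

Lemma Sigma_classP s t : Sigma_class s = Sigma_class t <-> Sigma_sim s t.
Proof.
apply: class_eqP;
  [exact: Sigma_sim_refl|exact: Sigma_sim_sym|exact: Sigma_sim_trans].
Qed.

Lemma Sigma_class_reprK (x : SigmaQ) : Sigma_class (class_repr x) = x.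
Proof. exact: class_reprK. Qed.

Definition Ebar (x : SigmaQ) : Ews A B := ws_class (E_sum (class_repr x)).

Lemma EbarE s : Ebar (Sigma_class s) = ws_class (E_sum s).
Proof.
apply/ws_classP; apply: rst_step.
have /Sigma_classP[g [_ [[_ _ [gM cg] _] [gi gp]]]] :
  Sigma_class (class_repr (Sigma_class s)) = Sigma_class s.
  exact: Sigma_class_reprK.
exists (@add_hom (sum_type (class_repr (Sigma_class s))) (sum_type s) g gM).
by split=> // -[b a]; exact: gp.
Qed.

Let BA := prodG B A.

Definition usual_op (x y : B * A) : B * A := (x.1 + y.1, x.2 + y.2).

Lemma usual_op_group :
  exists zero opp, topological_abelian_group usual_op zero opp.
Proof.
exists (0 : BA), (-%R : BA -> BA); split; first split.
- exact: (@addrA BA).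
- exact: (@addrC BA).
- exact: (@add0r BA).
- exact: (@addNr BA).
split; first exact: (@add_continuous BA).
exact: (@opp_continuous BA).
Qed.

Lemma usual_op_i1 : continuous_hom +%R usual_op (@i1 A B).
Proof.
by split=> [x y|]; [rewrite /usual_op /= addr0|exact: i1_cts].
Qed.

Lemma usual_op_p2 : continuous_hom usual_op +%R (@p2 A B).
Proof. by split=> //; exact: cts_snd. Qed.

Definition usual_sum : Sigma A B :=
  MkSigma usual_op_group usual_op_i1 usual_op_p2.

Lemma split_jD : {morph @i1 A B : x y / x + y >-> (x + y : BA)}.
Proof. by case: usual_op_i1. Qed.

Lemma split_pD : {morph @p2 A B : x y / (x + y : BA) >-> x + y}.
Proof. by []. Qed.

Definition split_ext : extension A B :=
  @Extension A B BA (add_hom split_jD) (add_hom split_pD)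
    (@cts_snd _ _) (@sum_p_surj A B usual_sum) (@sum_p_open A B usual_sum)
    (@sum_j_emb A B usual_sum) (@sum_j_ker A B usual_sum).

Lemma split_ws : weak_split split_ext.
Proof.
exists (fun a => (0, a) : BA); split=> //.
exact: cts_pair (@cts_cst _ _ _) (@cts_id _).
Qed.

Definition split_wsext : wsextension A B := WSExtension split_ws.

Definition Sigma_base : SigmaQ := Sigma_class usual_sum.
Definition Ews_base : Ews A B := ws_class split_wsext.

End SigmaClasses.

Definition abelian_group (T : Type) (add : T -> T -> T) (zero : T) :=
  [/\ associative add, commutative add, left_id zero add &
      forall x, exists y, add y x = zero].

Definition abelian_group_iso (T U : Type)
    (addT : T -> T -> T) (zeroT : T) (addU : U -> U -> U) (zeroU : U)
    (f : T -> U) :=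
  [/\ abelian_group addT zeroT, abelian_group addU zeroU,
      {morph f : x y / addT x y >-> addU x y} & bijective f].

(* Main.v *)
(** A continuous section s of a ws-extension has a cocycle
    f(a, b) = j^-1(s a + s b - s(a + b)), which is continuous because j is an
    embedding. The map (b, a) |-> j b + s a is then a topological isomorphism
    onto the extension from B * A with the sum twisted by f, so every class in
    E^ws comes from Sigma. A morphism of extensions carries sections to
    sections, and a section of its target lifts after correction by a
    continuous map A -> B; hence equivalent extensions have the same cocycles,
    which gives injectivity. Cocycles add under the Baer sum, so the group
    axioms reduce to those of functions A * A -> B. *)
From Stdlib Require Import Relations.
Require Import Defs.
From mathcomp Require Import all_boot all_order all_algebra.
From mathcomp Require Import all_classical all_reals all_analysis.

Set Implicit Arguments.
Unset Strict Implicit.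
Unset Printing Implicit Defensive.
Import GRing.Theory.
Local Open Scope classical_set_scope.
Local Open Scope ring_scope.

(** * Continuous sections and their cocycles *)

Section Cocycles.
Variables A B : topologicalZmodType.

(** The lift is chosen pointwise. It is continuous because, [ext_j] being an embedding, each open
    set of [B] is the preimage of an open set of the middle group. *)
Lemma ext_kernel_lift (E : extension A B) (T : topologicalType)
    (u : T -> ext_sort E) :
  continuous u -> (forall t, ext_p E (u t) = 0) ->
  exists2 h : T -> B, continuous h & forall t, ext_j E (h t) = u t.
Proof.
move=> cu pu; have /choice[h hE] : forall t, exists b, ext_j E b = u t.
  by move=> t; exact: ext_kerP.
exists h => //; apply/continuousP => O oO.
have [V oV ->] := ext_j_open E oO.
rewrite (_ : _ @^-1` _ = u @^-1` V); first exact: cts_open.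
by apply/funext => t /=; rewrite hE.
Qed.

(** A relation, since every continuous section of [E] has its own cocycle. Continuity of [f] is not
    imposed: it follows in [has_cocycleP]. *)
Definition has_cocycle (E : extension A B) (f : A * A -> B) :=
  exists s : A -> ext_sort E,
    [/\ continuous s, cancel s (ext_p E), s 0 = 0 &
        forall a b, s a + s b = ext_j E (f (a, b)) + s (a + b)].

Record is_cocycle (f : A * A -> B) : Prop := IsCocycle {
  cocycle_cts : continuous f ;
  cocycleC : forall a b, f (a, b) = f (b, a) ;
  cocycle0 : forall a, f (0, a) = 0 ;
  cocycleA : forall a b c, f (a, b) + f (a + b, c) = f (b, c) + f (a, b + c) }.

Lemma ws_has_cocycle (E : wsextension A B) : exists f, has_cocycle E f.
Proof.
case: (ws_split E) => s [cs sK s0].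
have /choice[f fE] : forall z : A * A, exists b,
    ext_j E b = s z.1 + s z.2 - s (z.1 + z.2).
  by move=> z; apply: ext_kerP; rewrite raddfB raddfD /= !sK subrr.
by exists f, s; split=> // a b; rewrite fE subrK.
Qed.

(** After the injective [ext_j], [f (a, b)] becomes [s a + s b - s (a + b)]. In the cocycle identity
    both sides, once [s (a + b + c)] is added, equal [s a + s b + s c]. *)
Lemma has_cocycleP (E : extension A B) f : has_cocycle E f -> is_cocycle f.
Proof.
move=> [s [cs sK s0 sD]].
have c1 : continuous (fun z : A * A => s z.1) := cts_comp (@cts_fst _ _) cs.
have c2 : continuous (fun z : A * A => s z.2) := cts_comp (@cts_snd _ _) cs.
have c3 : continuous (fun z : A * A => s (z.1 + z.2)).
  by apply: cts_comp cs; exact: add_continuous.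
have jf a b : ext_j E (f (a, b)) = s a + s b - s (a + b) by rewrite sD addrK.
split.
- have [|h ch hE] := ext_kernel_lift (cts_add (cts_add c1 c2) (cts_opp c3)).
    by move=> z; rewrite raddfB raddfD /= !sK subrr.
  rewrite (_ : f = h) //; apply/funext => -[a b]; apply: (@ext_j_inj _ _ E).
  by rewrite hE jf.
- by move=> a b; apply: (@ext_j_inj _ _ E); rewrite !jf (addrC a) (addrC (s a)).
- by move=> a; apply: (@ext_j_inj _ _ E); rewrite jf s0 !add0r subrr raddf0.
- move=> a b c; apply: (@ext_j_inj _ _ E); apply: (addIr (s (a + b + c))).
  rewrite !raddfD /=; transitivity (s a + s b + s c).
    by rewrite -addrA -sD addrA -sD.
  by rewrite -[RHS]addrA -(addrA a) -sD addrCA -sD addrA.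
Qed.

(** * The sum on [B * A] twisted by a cocycle *)

Section CocycleSum.
Variables (f : A * A -> B) (fP : is_cocycle f).

(** The group law of an extension in the coordinates [(b, a)] of the point [j b + s a]. *)
Definition cocycle_op (x y : B * A) : B * A :=
  (x.1 + y.1 + f (x.2, y.2), x.2 + y.2).

Lemma cocycle_op_group :
  exists zero opp, topological_abelian_group cocycle_op zero opp.
Proof.
(* The inverse solves [b' + b + f (- a, a) = 0] for [b']. *)
exists (0, 0), (fun x => (- x.1 - f (- x.2, x.2), - x.2)).
have cb1 : continuous (fun z : (B * A) * (B * A) => z.1.1).
  exact: cts_comp (@cts_fst _ _) (@cts_fst _ _).
have ca1 : continuous (fun z : (B * A) * (B * A) => z.1.2).
  exact: cts_comp (@cts_fst _ _) (@cts_snd _ _).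
have cb2 : continuous (fun z : (B * A) * (B * A) => z.2.1).
  exact: cts_comp (@cts_snd _ _) (@cts_fst _ _).
have ca2 : continuous (fun z : (B * A) * (B * A) => z.2.2).
  exact: cts_comp (@cts_snd _ _) (@cts_snd _ _).
split; first split.
- move=> [b a] [b' a'] [b'' a'']; rewrite /cocycle_op /=.
  rewrite [a + (_ + _)]addrA; congr (_, _).
  transitivity (b + b' + b'' + (f (a', a'') + f (a, a' + a''))).
    by rewrite !addrA.
  by rewrite -(cocycleA fP) addrA (addrAC _ b'').
- by move=> [b a] [b' a']; rewrite /cocycle_op /= (cocycleC fP) ![_ + b]addrC
    [a + _]addrC.
- by move=> [b a]; rewrite /cocycle_op /= (cocycle0 fP) !add0r addr0.
- by move=> [b a]; rewrite /cocycle_op /= addNr addrAC subrK addNr.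
split.
  apply: cts_pair; last exact: cts_add.
  apply: cts_add; first exact: cts_add.
  by apply: cts_comp (cocycle_cts fP); exact: cts_pair.
have c2 : continuous (fun x : B * A => - x.2).
  by apply: cts_opp; exact: cts_snd.
apply: cts_pair; last exact: c2.
apply: cts_add.
  by apply: cts_opp; exact: cts_fst.
apply: cts_opp; apply: cts_comp (cocycle_cts fP).
by apply: cts_pair c2 _; exact: cts_snd.
Qed.

Lemma cocycle_op_i1 : continuous_hom +%R cocycle_op (@i1 A B).
Proof.
split; last exact: i1_cts.
by move=> x y; rewrite /cocycle_op /i1 /= (cocycle0 fP) !addr0.
Qed.

Lemma cocycle_op_p2 : continuous_hom cocycle_op +%R (@p2 A B).
Proof. by split=> //; exact: cts_snd. Qed.

Definition cocycle_sum : Sigma A B :=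
  MkSigma cocycle_op_group cocycle_op_i1 cocycle_op_p2.

Section Parametrization.
Variables (E : extension A B) (s : A -> ext_sort E).
Hypotheses (cs : continuous s) (sK : cancel s (ext_p E)).
Hypothesis sD : forall a b, s a + s b = ext_j E (f (a, b)) + s (a + b).

Definition cocycle_par (x : sum_type cocycle_sum) : ext_sort E :=
  ext_j E x.1 + s x.2.

Lemma cocycle_parD : {morph cocycle_par : x y / x + y >-> x + y}.
Proof.
move=> x y; rewrite /cocycle_par addrACA sD addrA -!raddfD /=.
by [].
Qed.

Lemma cocycle_par_cts : continuous cocycle_par.
Proof.
apply: (@cts_add (B * A)%type).
  exact: cts_comp (@cts_fst _ _) (@ext_j_cts _ _ E).
exact: cts_comp (@cts_snd _ _) cs.
Qed.

Lemma cocycle_parP x : ext_p E (cocycle_par x) = x.2.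
Proof. by rewrite raddfD /= ext_pj add0r sK. Qed.

(** The inverse sends [x] to the pair of [j^-1 (x - s (p x))] and [p x]; the first coordinate is
    continuous by [ext_kernel_lift]. *)
Lemma cocycle_par_inverse :
  exists g : ext_sort E -> sum_type cocycle_sum,
    [/\ continuous g, cancel cocycle_par g & cancel g cocycle_par].
Proof.
have [||h ch hE] := @ext_kernel_lift E _ (fun x => x - s (ext_p E x)).
- apply: cts_add (@cts_id _) _; apply: cts_opp.
  exact: cts_comp (@ext_p_cts _ _ E) cs.
- by move=> x; rewrite raddfB /= sK subrr.
exists (fun x => (h x, ext_p E x)); split.
- exact: (@cts_pair _ B A _ _ ch (@ext_p_cts _ _ E)).
- move=> x; rewrite [RHS]surjective_pairing cocycle_parP; congr (_, _).
  by apply: (@ext_j_inj _ _ E); rewrite hE cocycle_parP addrK.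
- by move=> x; rewrite /cocycle_par /= hE subrK.
Qed.

End Parametrization.

Lemma cocycle_sum_has_cocycle : has_cocycle (E_sum cocycle_sum) f.
Proof.
exists (fun a => (0, a) : sum_type cocycle_sum); split=> //.
- exact: cts_pair (@cts_cst _ _ _) (@cts_id _).
(* The zero of [sum_type] comes from a choice; it is [(0, 0)] because [i1] preserves zero. *)
- exact: (raddf0 (add_hom (@sum_jD A B cocycle_sum))).
- move=> a b; rewrite /= /sum_j /i1 /GRing.add /= /cocycle_op /=.
  by rewrite (cocycle0 fP) !add0r !addr0.
Qed.

Lemma cocycle_sum_class (E : wsextension A B) :
  has_cocycle E f -> ws_class (E_sum cocycle_sum) = ws_class E.
Proof.
move=> [s [cs sK s0 sD]]; apply/ws_classP; apply: rst_step.
exists (add_hom (cocycle_parD sD)); split.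
- exact: cocycle_par_cts.
- by move=> b; rewrite /= /cocycle_par /= s0 addr0.
- exact: cocycle_parP.
Qed.

(** For [E_sum s] the parametrization maps [B * A] to itself, and its continuous inverse makes it
    the isomorphism that [Sigma_sim] asks for. *)
Lemma cocycle_sum_sim (s : Sigma A B) :
  has_cocycle (E_sum s) f -> Sigma_sim cocycle_sum s.
Proof.
move=> [t [ct tK t0 tD]].
have [g [cg gK Kg]] := cocycle_par_inverse ct tK.
exists (cocycle_par t), g; split; first split=> //.
- by split; [exact: cocycle_parD tD|exact: (cocycle_par_cts ct)].
- by split=> // x y; apply: (can_inj gK); rewrite (cocycle_parD tD) !Kg.
split=> [b|b a]; last exact: (cocycle_parP tK (b, a)).
by rewrite /cocycle_par /= t0; exact: (@addr0 (sum_type s)).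
Qed.

End CocycleSum.

(** * Invariance of cocycles under equivalence, and bijectivity of [Ebar] *)

Lemma ext_morph_inj (E E' : extension A B)
    (t : {additive ext_sort E -> ext_sort E'}) :
  (forall b, t (ext_j E b) = ext_j E' b) ->
  (forall x, ext_p E' (t x) = ext_p E x) -> injective t.
Proof.
move=> tj tp x y txy; apply/eqP; rewrite -subr_eq0.
have t0 : t (x - y) = 0 by rewrite raddfB txy subrr.
have /ext_kerP[b bE] : ext_p E (x - y) = 0 by rewrite -tp t0 raddf0.
rewrite -bE (_ : b = 0) ?raddf0 //; apply: (@ext_j_inj _ _ E').
by rewrite -tj bE t0 raddf0.
Qed.

(** Having both directions lets the result pass through the symmetric steps of [ws_equiv], without
    inverting the morphism. *)
Lemma ext_morph_has_cocycle (E : wsextension A B) (E' : extension A B) f :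
  ext_morph E E' -> has_cocycle E f <-> has_cocycle E' f.
Proof.
move=> [t [ct tj tp]]; split=> -[s [cs sK s0 sD]].
  exists (fun a => t (s a)); split.
  - exact: cts_comp cs ct.
  - by move=> a; rewrite tp sK.
  - by rewrite s0 raddf0.
  - by move=> a b; rewrite -raddfD sD raddfD tj.
(* Two sections of E' differ by a continuous map into B, so any section of E
   can be corrected to one lying over s. *)
case: (ws_split E) => r [cr rK r0].
have [||h ch hE] := @ext_kernel_lift E' _ (fun a => s a - t (r a)).
- by apply: cts_add cs _; apply: cts_opp; exact: cts_comp cr ct.
- by move=> a; rewrite raddfB tp sK rK subrr.
have tE a : t (r a + ext_j E (h a)) = s a.
  by rewrite raddfD tj hE addrC subrK.
exists (fun a => r a + ext_j E (h a)); split.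
- apply: cts_add cr _; exact: cts_comp ch (@ext_j_cts _ _ E).
- by move=> a; rewrite raddfD /= rK ext_pj addr0.
(* Since [t] is injective, identities for the corrected section can be checked in [E'], where it
   becomes [s]. *)
- by apply: (ext_morph_inj tj tp); rewrite /= tE s0 raddf0.
- move=> a b; apply: (ext_morph_inj tj tp).
  by rewrite [LHS]raddfD [RHS]raddfD /= !tE tj sD.
Qed.

Lemma ws_equiv_has_cocycle (E E' : wsextension A B) f :
  ws_equiv E E' -> has_cocycle E f <-> has_cocycle E' f.
Proof.
elim=> [x y|x|x y _ IH|x y z _ xy _ yz].
- exact: ext_morph_has_cocycle.
- by [].
- by split=> /IH.
- exact: iff_trans xy yz.
Qed.

(** Both classes are that of the twisted sum of [f]. Equalities in [Ews] thus reduce to equalities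
    of cocycles. *)
Lemma has_cocycle_ws_class (E E' : wsextension A B) f :
  has_cocycle E f -> has_cocycle E' f -> ws_class E = ws_class E'.
Proof.
move=> Ef E'f; have fP := has_cocycleP Ef.
by rewrite -(cocycle_sum_class fP Ef) (cocycle_sum_class fP E'f).
Qed.

(** A cocycle of [E_sum s] is also one of [E_sum t], so [s] and [t] are both similar to its twisted
    sum. *)
Lemma E_sum_inj (s t : Sigma A B) :
  ws_class (E_sum s) = ws_class (E_sum t) -> Sigma_sim s t.
Proof.
move=> /ws_classP st; have [f sf] := ws_has_cocycle (E_sum s).
have fP := has_cocycleP sf.
apply: (Sigma_sim_trans (Sigma_sim_sym (cocycle_sum_sim fP sf))).
by apply: cocycle_sum_sim; apply/(ws_equiv_has_cocycle _ st).
Qed.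

Lemma Ebar_bijective : bijective (@Ebar A B).
Proof.
have inj : injective (@Ebar A B).
  move=> x y; rewrite -(Sigma_class_reprK x) -(Sigma_class_reprK y) !EbarE.
  by move=> /E_sum_inj /Sigma_classP.
have /choice[g gK] : forall y : Ews A B, exists x, Ebar x = y.
  move=> y; have [f yf] := ws_has_cocycle (class_repr y).
  exists (Sigma_class (cocycle_sum (has_cocycleP yf))).
  by rewrite EbarE (cocycle_sum_class _ yf) ws_class_reprK.
by exists g => // x; apply: inj; rewrite gK.
Qed.

(** * Base points, Baer sums and the group axioms *)

Lemma usual_sum_has_cocycle : has_cocycle (E_sum (usual_sum A B)) (fun=> 0).
Proof.
exists (fun a => (0, a) : sum_type (usual_sum A B)); split=> //.
- exact: cts_pair (@cts_cst _ _ _) (@cts_id _).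
- exact: (raddf0 (add_hom (@sum_jD A B (usual_sum A B)))).
- move=> a b; rewrite raddf0 add0r.
  by rewrite /GRing.add /= /usual_op /= addr0.
Qed.

(** Sharing the zero cocycle with [E_sum (usual_sum A B)] is what identifies the two base points. *)
Lemma split_has_cocycle : has_cocycle (split_wsext A B) (fun=> 0).
Proof.
exists (fun a => (0, a) : prodG B A); split=> //.
- exact: cts_pair (@cts_cst _ _ _) (@cts_id _).
- move=> a b; rewrite raddf0 add0r.
  by congr (_, _); rewrite addr0.
Qed.

Lemma baer_has_cocycle (E E' : wsextension A B) f g :
  has_cocycle E f -> has_cocycle E' g ->
  has_cocycle (baer E E') (fun z => f z + g z).
Proof.
move=> [s [cs sK s0 sD]] [r [cr rK r0 rD]].
pose P := prod_ext E E'; pose c := add_hom (@codiagD B).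
pose Q : extension (prodG A A) B := @pushout_ext _ _ _ P c (@codiag_cts B).
(* The section of the Baer sum is [a |-> (u a, a)]; the pushout along the codiagonal turns the
   product cocycle [(f, g)] into [f + g]. *)
pose u a : ext_sort Q := @pushout_pi _ _ _ P c (0, (s a, r a)).
have uP a : @pullback_set _ _ _ Q (add_hom (@diagD A)) (u a, a).
  by rewrite /pullback_set /= pushout_pE /= /prod_p /= sK rK.
exists (fun a => pullback_mk (uP a)); split.
- apply: pullback_ctsP; apply: cts_pair (@cts_id _).
  apply: (@cts_comp _ _ _ (fun a : A => (0 : B, (s a, r a))))
    (@pushout_pi_cts _ _ _ P c).
  by apply: cts_pair; [exact: cts_cst|exact: cts_pair].
- by [].
- apply: val_inj => /=; rewrite /u s0 r0.
  by congr (_, _); exact: (raddf0 (add_hom (@pushout_piD _ _ _ P c))).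
- move=> a b; apply: val_inj; congr (_, _); last by rewrite /= add0r.
  rewrite /= /u /pushout_j -!pushout_piD; apply/pushout_piP.
  (* The signs match the pairs [(c b, - j b)] divided out in the pushout: the difference has first
     coordinate [- (f + g)] and second coordinate [(j f, j' g)]. *)
  exists (- f (a, b), - g (a, b)).
  congr (_, _) => /=.
    by rewrite !addr0 sub0r opprD.
  have sE : s a + s b - s (a + b) = - - ext_j E (f (a, b)).
    by rewrite sD addrK opprK.
  have rE : r a + r b - r (a + b) = - - ext_j E' (g (a, b)).
    by rewrite rD addrK opprK.
  by rewrite add0r /prod_j /= !raddfN /=; congr (_, _); [exact: sE|exact: rE].
Qed.

Lemma baer_add_class (E E' F : wsextension A B) f g :
  has_cocycle E f -> has_cocycle E' g ->
  has_cocycle F (fun z => f z + g z) ->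
  baer_add (ws_class E) (ws_class E') = ws_class F.
Proof.
move=> Ef E'g; rewrite baer_addE; apply: has_cocycle_ws_class.
exact: baer_has_cocycle.
Qed.

Lemma is_cocycleN f : is_cocycle f -> is_cocycle (fun z => - f z).
Proof.
move=> [cf fC f0 fA]; split.
- exact: cts_opp.
- by move=> a b; rewrite fC.
- by move=> a; rewrite f0 oppr0.
- by move=> a b c; rewrite -!opprD fA.
Qed.

Lemma ws_class_has_cocycle (x : Ews A B) :
  exists E f, x = ws_class E /\ has_cocycle (ws_ext E) f.
Proof.
have [f xf] := ws_has_cocycle (class_repr x).
by exists (class_repr x), f; rewrite ws_class_reprK.
Qed.

Lemma baer_abelian_group : abelian_group (@baer_add A B) (Ews_base A B).
Proof.
split.
- move=> x y z; have [E [f [-> Ef]]] := ws_class_has_cocycle x.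
  have [E' [g [-> E'g]]] := ws_class_has_cocycle y.
  have [F [h [-> Fh]]] := ws_class_has_cocycle z.
  rewrite !baer_addE; apply: (@has_cocycle_ws_class _ _
    (fun z => f z + g z + h z)); last by do 2!apply: baer_has_cocycle => //.
  rewrite (_ : (fun z => _) = fun z => f z + (g z + h z)); last first.
    by apply/funext => t; rewrite addrA.
  by do 2!apply: baer_has_cocycle => //.
- move=> x y; have [E [f [-> Ef]]] := ws_class_has_cocycle x.
  have [E' [g [-> E'g]]] := ws_class_has_cocycle y.
  rewrite [RHS]baer_addE; apply: (baer_add_class Ef E'g).
  rewrite (_ : (fun z => _) = fun z => g z + f z); last first.
    by apply/funext => t; rewrite addrC.
  exact: baer_has_cocycle.
- move=> x; have [E [f [-> Ef]]] := ws_class_has_cocycle x.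
  apply: (baer_add_class split_has_cocycle Ef).
  by rewrite (_ : (fun z => _) = f) //; apply/funext => t; rewrite add0r.
- move=> x; have [E [f [-> Ef]]] := ws_class_has_cocycle x.
  (* The inverse class is represented by the sum twisted by [- f]. *)
  have fP := is_cocycleN (has_cocycleP Ef).
  exists (ws_class (E_sum (cocycle_sum fP))).
  apply: (baer_add_class (cocycle_sum_has_cocycle fP) Ef).
  rewrite (_ : (fun z => _) = fun=> 0); first exact: split_has_cocycle.
  by apply/funext => t; rewrite addNr.
Qed.

End Cocycles.

(** * Transport of the group structure along a bijection *)

Lemma abelian_group_transport (T U : Type) (addU : U -> U -> U) (zeroU : U)
    (f : T -> U) (zeroT : T) :
  bijective f -> f zeroT = zeroU -> abelian_group addU zeroU ->
  exists addT, abelian_group_iso addT zeroT addU zeroU f.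
Proof.
move=> fbij; case: (fbij) => g fK gK <- UG.
(* As [f] matches the base points, [zeroT] is the neutral element of the law pulled back along
   [f]. *)
exists (fun x y => g (addU (f x) (f y))).
case: (UG) => addA addC add0 addN; split=> //.
  split.
  - by move=> x y z; rewrite !gK addA.
  - by move=> x y; rewrite addC.
  - by move=> x; rewrite add0 fK.
  - by move=> x; have [y yE] := addN (f x); exists (g y); rewrite gK yE fK.
Qed.

Theorem theorem3p1 (A B : topologicalZmodType) :
  [/\ forall s : Sigma A B, Ebar (Sigma_class s) = ws_class (E_sum s),
      bijective (@Ebar A B)
    & Ebar (Sigma_base A B) = Ews_base A B] /\
  exists add : SigmaQ A B -> SigmaQ A B -> SigmaQ A B,
    abelian_group_iso add (Sigma_base A B) (@baer_add A B) (Ews_base A B)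
      (@Ebar A B).
Proof.
have base : Ebar (Sigma_base A B) = Ews_base A B.
  rewrite EbarE.
  exact: has_cocycle_ws_class (usual_sum_has_cocycle A B)
    (split_has_cocycle A B).
split; first by split; [exact: EbarE|exact: Ebar_bijective|].
apply: abelian_group_transport base _; first exact: Ebar_bijective.
exact: baer_abelian_group.
Qed.
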